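(* Let $d$, $m$, and $n$ be positive integers such that $1<d<m\le n$. Suppose that $\left(\frac1m,\frac1{m-1}\right)$ and $\left(\frac dm,\frac d{m-1}\right)$ are Farey pairs of order $n$. For $\alpha\in[0,1]$ and $\beta:=1-\alpha$, let $M(\alpha)$ be the $m$-by-$m$ nonnegative companion matrix of $f_\alpha(t)=t^m-\beta t-\alpha$, that is, $$M(\alpha)=\begin{bmatrix} 0 & I_{m-1}\\ \alpha & \beta e_1^\top\end{bmatrix},$$ where $e_1\in\mathbb{R}^{m-1}$ is the first standard basis vector, and put $\mathcal{M}^d:=\{M(\alpha)^d:\alpha\in[0,1]\}$. (i) If $d$ divides $m$ and $k=m/d$, then $\mathcal{M}^d$ forms a set of realizing-matrices for the K-arc $K_n\left(\frac1k,\frac d{m-1}\right)$. (ii) If $d$ divides $m-1$ and $m>k\lfloor n/k\rfloor$, where $k=(m-1)/d$, then $\mathcal{M}^d$ forms a set of realizing-matrices for the K-arc $K_n\left(\frac dm,\frac1k\right)$. Here, ''$\mathcal{M}^d$ forms a set of realizing-matrices for an arc'' means that every point $\lambda$ of the arc is an eigenvalue of some matrix in $\mathcal{M}^d$.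
   Context: $\Theta_n\subset\mathbb{C}$ denotes the set of all individual eigenvalues of all $n$-by-$n$ (row) stochastic matrices. $F_n:=\{p/q : 0\le p<q\le n,\ \gcd(p,q)=1\}$ is the set of Farey fractions of order $n$. If $x<y$ are elements of $F_n$ and no element of $F_n$ lies strictly between them, $(x,y)$ is called a Farey pair of order $n$; $x,y$ are then called Farey neighbors. Fractions such as $d/m$ are regarded as rational numbers (to be reduced to lowest terms when needed). By the Karpelevič theorem (in the form due to Ito), $\Theta_n$ meets the unit circle exactly at the points $e^{2\pi\mathrm{i}x}$, $x\in F_n$, and the boundary of $\Theta_n$ consists of these points and of curvilinear arcs (K-arcs) connecting them in circular order. For Farey neighbors $x,y$ of order $n$, $K_n(x,y)$ denotes the arc connecting $e^{2\pi\mathrm{i}x}$ and $e^{2\pi\mathrm{i}y}$. If the two fractions, in lowest terms, are named $p/q$ and $r/s$ with $q<s$, then the arc is given by the parametric equation $$t^{s}\left(t^{q}-\beta\right)^{\lfloor n/q\rfloor}=\alpha^{\lfloor n/q\rfloor}\,t^{q\lfloor n/q\rfloor},\qquad \alpha\in[0,1],\ \beta:=1-\alpha,$$ i.e. each point $\lambda=\lambda(\alpha)$ of the arc satisfies this equation for the corresponding parameter value $\alpha$. A realizing-matrix for a point $\lambda$ is a matrix whose spectrum contains $\lambda$. *)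

(* Defs.v *)
From HB Require Import structures.
From mathcomp Require Import all_boot all_order all_algebra.
From mathcomp Require Import all_classical all_reals all_analysis.
From mathcomp Require Import complex.

Set Implicit Arguments.
Unset Strict Implicit.
Unset Printing Implicit Defensive.

Import Order.TTheory GRing.Theory Num.Theory.
Import numFieldNormedType.Exports.

Local Open Scope classical_set_scope.
Local Open Scope complex_scope.
Local Open Scope ring_scope.

(* Spectra of real matrices are taken over the complex numbers R[i]. *)
Definition in_spectrum (R : realType) (n : nat) (A : 'M[R]_n) (l : R[i]) : Prop :=
  eigenvalue (map_mx (real_complex R) A) l.

Definition row_stochastic (R : realType) (n : nat) (A : 'M[R]_n) : Prop :=
  (forall i j, 0 <= A i j) /\ (forall i, \sum_j A i j = 1).

Definition Theta (R : realType) (n : nat) : set R[i] :=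
  [set l | exists A : 'M[R]_n, row_stochastic A /\ in_spectrum A l].

Definition boundary (T : topologicalType) (A : set T) : set T :=
  closure A `\` interior A.

Definition Farey (n : nat) : set rat :=
  [set x | exists p q : nat,
     [/\ (p < q)%N, (q <= n)%N, coprime p q & x = p%:R / q%:R]].

Definition Farey_pair (n : nat) (x y : rat) : Prop :=
  [/\ Farey n x, Farey n y, x < y &
      forall z, Farey n z -> ~ (x < z /\ z < y)].

(* e^(2 pi i theta) *)
Definition unit_circle (R : realType) (theta : R) : R[i] :=
  cos (2 * pi * theta) +i* sin (2 * pi * theta).

Definition sector (R : realType) (x y : R) : set R[i] :=
  [set z | exists r theta : R,
     [/\ 0 <= r, x <= theta, theta <= y & z = r%:C * unit_circle theta]].

Definition Ito_equation (R : realType) (n q s : nat) (alpha : R) (t : R[i]) : Prop :=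
  let beta := 1 - alpha in
  t ^+ s * (t ^+ q - beta%:C) ^+ (n %/ q)
    = alpha%:C ^+ (n %/ q) * t ^+ (q * (n %/ q)).

(* K_n(x,y): the part of the boundary of Theta_n running from e^(2 pi i x) to
   e^(2 pi i y), as described by the Karpelevic-Ito parametric equation.  For a
   fixed alpha that equation also has roots which are not on the arc (conjugate
   or interior ones); membership in the boundary and in the sector between the
   two endpoints singles out the point lambda(alpha).  The equation depends only
   on the two reduced denominators, q being the smaller and s the larger. *)
Definition K_arc (R : realType) (n : nat) (x y : rat) : set R[i] :=
  let q := minn `|denq x| `|denq y| in
  let s := maxn `|denq x| `|denq y| in
  [set l | [/\ boundary (@Theta R n : set R[i]^o) l,
               sector (ratr x) (ratr y) l &
               exists2 alpha : R, 0 <= alpha <= 1 & Ito_equation n q s alpha l]].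

(* The block matrix [0, I_(m-1); alpha, beta e_1^T], entrywise, 0-indexed. *)
Definition companion_M (R : realType) (m : nat) (alpha : R) : 'M[R]_m :=
  \matrix_(i < m, j < m)
    if (i.+1 < m)%N then (j == i.+1 :> nat)%:R
    else if j == 0%N :> nat then alpha
    else if j == 1%N :> nat then 1 - alpha
    else 0.

Definition M_powers (R : realType) (m d : nat) : set 'M[R]_m :=
  [set companion_M m alpha ^+ d | alpha in [set alpha : R | 0 <= alpha <= 1]].

Definition realizing_set (R : realType) (m : nat) (S : set 'M[R]_m)
    (K : set R[i]) : Prop :=
  forall l, K l -> exists A, S A /\ in_spectrum A l.

(* Main.v *)
(** If [mu ^+ d = t], then [t] is an eigenvalue of [M(alpha)^d] as soon as [mu]
    is a root of [f_alpha].  The Farey condition in (i), and the hypothesis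
    [k * (n %/ k) < m] in (ii), force [n %/ k = d], so for [t <> 0] the Ito
    equation reads [(t^k - beta)^d = alpha^d t] in (i) and
    [t (t^k - beta)^d = alpha^d] in (ii).  For [alpha <> 0], [mu = (t^k - beta) / alpha],
    respectively [mu = alpha / (t^k - beta)], is a [d]-th root of [t], and its
    defining relation is [f_beta(mu) = 0], respectively [f_alpha(mu) = 0]. *)
Require Import Defs.
From HB Require Import structures.
From mathcomp Require Import all_boot all_order all_algebra.
From mathcomp Require Import all_classical all_reals all_analysis.
From mathcomp Require Import complex.
From mathcomp Require Import zify.

Set Implicit Arguments.
Unset Strict Implicit.
Unset Printing Implicit Defensive.

Import Order.TTheory GRing.Theory Num.Theory.

Local Open Scope ring_scope.

(** [eigenvalue] is defined through row vectors; a nonzero column killed by [A - a%:M] makes that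
    matrix singular, so column eigenvectors serve too. *)
Lemma eigenvalue_right (F : fieldType) (n : nat) (A : 'M[F]_n) (u : 'cV[F]_n)
    (a : F) :
  u != 0 -> A *m u = a *: u -> eigenvalue A a.
Proof.
move=> u0 Au; rewrite /eigenvalue /eigenspace kermx_eq0 row_free_unit.
apply: contra u0 => Aa_unit; rewrite -(mulKmx Aa_unit u).
by rewrite mulmxBl Au mul_scalar_mx subrr mulmx0.
Qed.

Lemma mulmx_expr_eigen (F : comNzRingType) (n d : nat) (A : 'M[F]_n)
    (u : 'cV[F]_n) (a : F) :
  A *m u = a *: u -> (A ^+ d) *m u = a ^+ d *: u.
Proof.
move=> Au; elim: d => [|d IHd]; first by rewrite !expr0 mul1mx scale1r.
by rewrite exprS -mulmxA IHd -scalemxAr Au scalerA -exprSr.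
Qed.

Lemma companion_M_eigen (R : realType) (m : nat) (a : R) (mu : R[i]) :
  (1 < m)%N -> mu ^+ m = (1 - a)%:C%C * mu + a%:C%C ->
  map_mx (real_complex R) (companion_M m a) *m (\col_(i < m) mu ^+ i)
    = mu *: \col_(i < m) mu ^+ i.
Proof.
move=> m1 fmu; apply/matrixP=> i j; rewrite !mxE -exprS.
have [im|mi] := ltnP i.+1 m.
  rewrite (bigD1 (Ordinal im)) //= !mxE /= im eqxx rmorph1 mul1r big1 ?addr0//.
  move=> l lne; rewrite !mxE im.
  have /negPf -> : l != i.+1 :> nat by exact: lne.
  by rewrite rmorph0 mul0r.
have -> : i.+1 = m by apply/eqP; rewrite eqn_leq ltn_ord.
(* In the last row only columns 0 and 1 contribute, giving [a + (1 - a) * mu]. *)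
rewrite (bigD1 (Ordinal (ltnW m1))) //= (bigD1 (Ordinal m1)) //=.
rewrite big1 => [|l /andP[l0 l1]].
  by rewrite !mxE /= ltnNge mi /= expr0 expr1 mulr1 addr0 addrC fmu.
rewrite !mxE ltnNge mi /=.
have /negPf -> : l != 0%N :> nat by exact: l0.
have /negPf -> : l != 1%N :> nat by exact: l1.
by rewrite rmorph0 mul0r.
Qed.

Lemma M_powers_spectrum (R : realType) (m d : nat) (a : R) (mu : R[i]) :
  (1 < m)%N -> 0 <= a <= 1 -> mu ^+ m = (1 - a)%:C%C * mu + a%:C%C ->
  exists A, @M_powers R m d A /\ in_spectrum A (mu ^+ d).
Proof.
move=> m1 a01 fmu; exists (companion_M m a ^+ d); split; first by exists a.
rewrite /in_spectrum.
have -> : map_mx (real_complex R) (companion_M m a ^+ d)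
    = map_mx (real_complex R) (companion_M m a) ^+ d.
  elim: d => [|d IHd]; first by rewrite !expr0 map_mx1.
  by rewrite !exprS map_mxM IHd.
apply: (eigenvalue_right _ (mulmx_expr_eigen d (companion_M_eigen m1 fmu))).
(* Entry 0 is [mu ^+ 0 = 1], so the vector is nonzero even when [mu = 0]. *)
apply/eqP => /matrixP/(_ (Ordinal (ltnW m1)) 0).
by rewrite !mxE expr0 => /eqP; rewrite oner_eq0.
Qed.

(** Settles [t = 0], where powers of [t] cannot be cancelled: 0 is a root of [f_0]. *)
Lemma M_powers_spectrum0 (R : realType) (m d : nat) :
  (1 < m)%N -> (0 < d)%N ->
  exists A, @M_powers R m d A /\ in_spectrum A 0.
Proof.
move=> m1 d0; have -> : 0 = 0 ^+ d :> R[i] by rewrite expr0n gtn_eqF.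
apply: (@M_powers_spectrum _ _ _ 0) => //; first by rewrite lexx ler01.
by rewrite expr0n gtn_eqF ?(ltnW m1)// mulr0 addr0.
Qed.

Lemma Ito_spectrum_mul (R : realType) (k d : nat) (a : R) (t : R[i]) :
  (1 < k * d)%N -> 0 <= a <= 1 ->
  (t ^+ k - (1 - a)%:C%C) ^+ d = a%:C%C ^+ d * t ->
  exists A, @M_powers R (k * d) d A /\ in_spectrum A t.
Proof.
move=> kd1 /andP[a0 a1] eqt.
have d0 : (0 < d)%N by lia.
have [az|an0] := eqVneq a 0.
  (* Here [t ^+ k = 1], and any [d]-th root of [t] is a root of [f_1]. *)
  move: eqt; rewrite az subr0 rmorph0 expr0n gtn_eqF// mul0r => /eqP.
  rewrite expf_eq0 d0 subr_eq0 /= => /eqP tk.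
  rewrite -(rootCK d0 t); apply: (@M_powers_spectrum _ _ _ 1) => //.
    by rewrite ler01 lexx.
  by rewrite mulnC exprM rootCK// tk subrr rmorph0 mul0r add0r.
have aC0 : a%:C%C != 0 by rewrite fmorph_eq0.
set mu := (t ^+ k - (1 - a)%:C%C) / a%:C%C.
have mud : mu ^+ d = t by rewrite expr_div_n eqt mulrC mulKf ?expf_neq0.
rewrite -mud; apply: (@M_powers_spectrum _ _ _ (1 - a)) => //.
  by rewrite subr_ge0 a1 gerBl a0.
by rewrite mulnC exprM mud subKr mulrC divfK// subrK.
Qed.

Lemma Ito_spectrum_mulS (R : realType) (k d : nat) (a : R) (t : R[i]) :
  (0 < k)%N -> (0 < d)%N -> 0 <= a <= 1 -> t != 0 ->
  t * (t ^+ k - (1 - a)%:C%C) ^+ d = a%:C%C ^+ d ->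
  exists A, @M_powers R (k * d).+1 d A /\ in_spectrum A t.
Proof.
move=> k0 d0 a01 t0 eqt.
have m1 : (1 < (k * d).+1)%N by rewrite ltnS muln_gt0 k0.
have [az|an0] := eqVneq a 0.
  (* Again [t ^+ k = 1], but now a [d]-th root [mu] of [t] satisfies [mu ^+ (k * d).+1 = mu], that
     is [f_0(mu) = 0]. *)
  move: eqt; rewrite az subr0 rmorph0 expr0n gtn_eqF// => /eqP.
  rewrite mulf_eq0 (negPf t0) expf_eq0 d0 subr_eq0 /= => /eqP tk.
  rewrite -(rootCK d0 t); apply: (@M_powers_spectrum _ _ _ 0) => //.
    by rewrite lexx ler01.
  by rewrite exprS mulnC exprM rootCK// tk subr0 rmorph0 addr0 mulrC.
have aC0 : a%:C%C != 0 by rewrite fmorph_eq0.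
have w0 : t ^+ k - (1 - a)%:C%C != 0.
  apply: contra_eq_neq eqt => ->.
  by rewrite expr0n gtn_eqF// mulr0 eq_sym expf_neq0.
set mu := a%:C%C / (t ^+ k - (1 - a)%:C%C).
have mud : mu ^+ d = t by rewrite expr_div_n -eqt mulfK ?expf_neq0.
rewrite -mud; apply: (@M_powers_spectrum _ _ _ a) => //.
rewrite exprS mulnC exprM mud -[t ^+ k](subrK (1 - a)%:C%C) mulrDr divfK//.
by rewrite addrC mulrC.
Qed.

Lemma denq_coprime (p q : nat) :
  (0 < q)%N -> coprime p q -> `|denq (p%:R / q%:R)|%N = q.
Proof.
move=> q0 cpq; have := @coprimeq_den p q; rewrite !pmulrn => -> //.
by rewrite eqz_nat gtn_eqF.
Qed.

(** Otherwise the mediant [(p + r) / (q + s)] would be a Farey fraction strictly between the two; it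
    is reduced because [(p + r) * q - p * (q + s) = 1]. *)
Lemma unimodular_Farey_pair (n p q r s : nat) :
  (p < q)%N -> (r < s)%N -> (r * q = p * s + 1)%N ->
  Farey_pair n (p%:R / q%:R) (r%:R / s%:R) -> (n < q + s)%N.
Proof.
move=> pq rs det [_ _ _ noF]; rewrite ltnNge; apply/negP => qsn.
have frac (a b c e : nat) : (0 < b)%N -> (0 < e)%N -> (a * e < c * b)%N ->
    a%:R / b%:R < c%:R / e%:R :> rat.
  move=> b0 e0 h; rewrite ltr_pdivrMr ?ltr0n// mulrAC ltr_pdivlMr ?ltr0n//.
  by rewrite -!natrM ltr_nat.
apply: (noF ((p + r)%:R / (q + s)%:R)).
  exists (p + r)%N, (q + s)%N; split=> //; first by lia.
  rewrite /coprime -dvdn1.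
  have h : ((p + r) * q = p * (q + s) + 1)%N by lia.
  rewrite -(dvdn_addr 1 (dvdn_mull p (dvdn_gcdr (p + r) (q + s)))) -h.
  exact: dvdn_mulr (dvdn_gcdl _ _).
by split; apply: frac; nia.
Qed.

Theorem theorem5p4 (R : realType) (d m n : nat) :
  (1 < d)%N -> (d < m)%N -> (m <= n)%N ->
  Farey_pair n (1 / m%:R) (1 / (m%:R - 1)) ->
  Farey_pair n (d%:R / m%:R) (d%:R / (m%:R - 1)) ->
  (forall k : nat, (d %| m)%N -> k = (m %/ d)%N ->
     realizing_set (@M_powers R m d)
       (@K_arc R n (1 / k%:R) (d%:R / (m%:R - 1))))
  /\
  (forall k : nat, (d %| m - 1)%N -> k = ((m - 1) %/ d)%N ->
     (k * (n %/ k) < m)%N ->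
     realizing_set (@M_powers R m d)
       (@K_arc R n (d%:R / m%:R) (1 / k%:R))).
Proof.
move=> d1 dm mn _ Fd.
have m1 : (1 < m)%N by lia.
have d0 : (0 < d)%N by lia.
have m1E : m%:R - 1 = (m - 1)%:R :> rat by rewrite natrB // ltnW.
rewrite m1E; split=> [k dvd kE|k dvd kE km] t [_ _ [a a01]].
- have [->|t0] := eqVneq t 0; first by move=> _; exact: M_powers_spectrum0.
  have mE : m = (k * d)%N by rewrite kE divnK.
  have k1 : (1 < k)%N by nia.
  have cd : coprime d (m - 1).
    by rewrite coprime_sym (coprime_dvdr dvd)// subn1 coprimePn// ltnW.
  rewrite -[1 / k%:R]/(1%:R / k%:R) !denq_coprime ?coprime1n//; try lia.
  have -> : minn k (m - 1) = k by nia.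
  have -> : maxn k (m - 1) = (m - 1)%N by nia.
  have dmE : d%:R / m%:R = 1%:R / k%:R :> rat.
    by rewrite mE natrM invfM mulrCA mulfV ?mulr1 ?div1r // pnatr_eq0 -lt0n.
  have dltm : (d < m - 1)%N by nia.
  (* The determinant of [1/k] and [d/(m-1)] is [d * k - (m - 1) = 1]. *)
  have nk : (n < k + (m - 1))%N.
    by apply: (@unimodular_Farey_pair n 1 k d (m - 1)); rewrite -?dmE -?m1E //; nia.
  (* From [k * d = m <= n < k * d + k - 1]. *)
  have nkE : (n %/ k)%N = d by nia.
  rewrite /Ito_equation nkE -mE => eqt; rewrite mE.
  apply: (@Ito_spectrum_mul _ _ _ a) => //; first by rewrite -mE.
  (* Cancelling [t ^+ (m - 1)] leaves one factor [t] on the right, since [k * d = m]. *)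
  apply: (mulfI (expf_neq0 (m - 1) t0)); rewrite eqt mulrCA -exprSr.
  by rewrite subn1 prednK ?(ltnW m1).
- have [->|t0] := eqVneq t 0; first by move=> _; exact: M_powers_spectrum0.
  have mE : m = (k * d).+1 by rewrite kE divnK// subn1 prednK ?(ltnW m1).
  have k0 : (0 < k)%N by nia.
  have cd : coprime d m.
    by rewrite mE -addn1 /coprime gcdnMDl gcdn1.
  rewrite -[1 / k%:R]/(1%:R / k%:R) !denq_coprime ?coprime1n//; try lia.
  have -> : minn m k = k by nia.
  have -> : maxn m k = m by nia.
  (* [k * d < m <= n] gives [d <= n %/ k], and [k * (n %/ k) < m = k * d + 1] gives the converse. *)
  have nkE : (n %/ k)%N = d by nia.
  rewrite /Ito_equation nkE mE => eqt.
  apply: (@Ito_spectrum_mulS _ _ _ a) => //.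
  by apply: (mulfI (expf_neq0 (k * d) t0)); rewrite mulrA -exprSr eqt mulrC.
Qed.
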